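(* Let $\mathcal{G}=(G_{[1]},\dots,G_{[N]})$ be a time-evolving network on the node set $[n]$ with time-evolving adjacency matrix $\mathcal{A}$, and let $\Psi(\mathcal{A},t)=\sum_{k=0}^\infty t^kP_k(\mathcal{A})$. Then, for all $0<t<t_0(\mathcal{A})$, it holds $$\Psi(\mathcal{A},t)=\Big[\,I-t\mathcal{A}\ast(E-t^2\mathcal{A}^{\ast T}\ast\mathcal{A})^{\ast(-1)}+\mathrm{dd}^{\ast}\Big(t\mathcal{A}\,\big(t\mathcal{A}\ast(E-t^2\mathcal{A}^{\ast T}\ast\mathcal{A})^{\ast(-1)}\big)\Big)\Big]^{-1}.$$
   Context: A finite time-evolving network $\mathcal{G}=(G_{[1]},\dots,G_{[N]})$ on $V=[n]=\{1,\dots,n\}$ is a finite sequence of weighted digraphs $G_{[s]}=(V,E_{[s]})$, $E_{[s]}\subseteq V\times V$ (loops allowed), with weight functions $\omega_{[s]}:E_{[s]}\to\mathbb{R}_{>0}$. The adjacency matrix $A_{[s]}\in\mathbb{R}^{n\times n}$ has $(v,w)$ entry $\omega_{[s]}(v,w)$ if $(v,w)\in E_{[s]}$ and $0$ otherwise. The time-evolving adjacency matrix $\mathcal{A}\in\mathbb{R}^{nN\times nN}$ is the block matrix with $n\times n$ blocks whose $(r,s)$ block is $A_{[s]}$ if $r\le s$ and $0$ if $r>s$. A walk of length $k\ge1$ is a sequence of nodes $i_1\dots i_{k+1}$ together with time frames $\sigma_1\le\dots\le\sigma_k$ in $\{1,\dots,N\}$ such that $(i_\ell,i_{\ell+1})\in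 E_{[\sigma_\ell]}$ for $\ell=1,\dots,k$; its weight is $\prod_{\ell=1}^k\omega_{[\sigma_\ell]}(i_\ell,i_{\ell+1})$. It is backtracking if $i_l=i_{l+2}$ for some $1\le l\le k-1$, and nonbacktracking otherwise. It begins on frame $\sigma_1$ and ends on frame $\sigma_k$. $P_0(\mathcal{A})=I$ (the $nN\times nN$ identity); for $k\ge1$, $P_k(\mathcal{A})\in\mathbb{R}^{nN\times nN}$ is the block matrix whose $(\tau_1,\tau_2)$ block counts (with weights) in its $(i,j)$ entry all nonbacktracking walks of length $k$ from node $i$ to node $j$ that begin at the earliest on time frame $\tau_1$ and end on time frame $\tau_2$; that is, the entry is the sum of the weights of these walks. Block matrices with $n\times n$ blocks are also regarded as elements of $R^{N\times N}$, where $R=(\mathbb{R}^{n\times n},+,\circ)$ and $\circ$ is the entrywise product. For such $A,B$: $(A\ast B)_{rs}=\sum_{k=1}^NA_{rk}\circ B_{ks}$, whereas juxtaposition $AB$ and the outer inverse $[\cdot]^{-1}$ denote ordinary matrix multiplication and inversion in $\mathbb{R}^{nN\times nN}$. $E$ is the identity for $\ast$, i.e. the block-diagonal matrix whose diagonal blocks are the all-ones matrix $\mathbf{1}\mathbf{1}^T$; $M^{\ast(-1)}$ is the inverse of $M$ with respect to $\ast$. $A^{\ast T}$ is obtained by transposing each block in place: $(A^{\ast T})_{rs}=(A_{rs})^T$. $\mathrm{dd}^\ast(A)$ is the block matrix with blocks $\mathrm{dd}(A_{rs})$, where $\mathrm{dd}(X)$ is the diagonal matrix with the same diagonal as $X$.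 $t_0(\mathcal{A}):=\big(\max_{i,j,s}\{(A_{[s]})_{ij}(A_{[s]})_{ji}\}\big)^{-1/2}$, read as $\infty$ if the maximum is $0$.
   Formalization: The series can diverge for some 0<t<t_0 (e.g. N=1, K_4 with unit weights, 1/2≤t<1), so the identity is stated for those t in (0,t_0) where the series converges, and otherwise for the value at t of the rational generating function, which exists iff the bracket is invertible. *)

(* Defs.v *)
From HB Require Import structures.
From mathcomp Require Import all_boot all_order all_algebra.
From mathcomp Require Import all_classical all_reals all_analysis.

Set Implicit Arguments.
Unset Strict Implicit.
Unset Printing Implicit Defensive.
Import Order.TTheory GRing.Theory Num.Theory.
Import numFieldNormedType.Exports.

Local Open Scope classical_set_scope.
Local Open Scope ring_scope.

(* The value of [weight] outside [edges] is irrelevant. *)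
Record wdigraph (R : realType) (n : nat) := WDigraph {
  edges : {set 'I_n * 'I_n};
  weight : 'I_n * 'I_n -> R;
  weight_gt0 : forall e, e \in edges -> 0 < weight e }.

(* Time frames are numbered from 0, as are the nodes. *)
Definition tenetwork (R : realType) (n N : nat) := 'I_N -> wdigraph R n.

Definition adj (R : realType) (n : nat) (G : wdigraph R n) : 'M[R]_n :=
  \matrix_(v, w) if (v, w) \in edges G then weight G (v, w) else 0.

(* The nN x nN matrices, partitioned into N x N blocks of size n x n; the
   library operations [mxblock] and [submxblock] assemble and extract blocks. *)
Notation "''BM[' R ]_ ( n , N )" := 'M[R]_(\sum_(_ < N) n)%N
  (at level 0, n at level 9, N at level 9, format "''BM[' R ]_ ( n ,  N )").

Definition blk (R : realType) (n N : nat) (A : 'BM[R]_(n, N)) (r s : 'I_N) :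
  'M[R]_n := @submxblock R N N (fun=> n) (fun=> n) A r s.

Definition of_blk (R : realType) (n N : nat) (B : 'I_N -> 'I_N -> 'M[R]_n) :
  'BM[R]_(n, N) := \mxblock_(r < N, s < N) B r s.

Definition te_adj (R : realType) (n N : nat) (G : tenetwork R n N) :
  'BM[R]_(n, N) := of_blk (fun r s => if (r <= s)%N then adj (G s) else 0).

(* A walk of length k has nodes x 0, ..., x k and frames sg 0, ..., sg (k - 1);
   its l-th step goes from x l to x l.+1 on frame sg l. *)
Definition step (n k : nat) (x : {ffun 'I_k.+1 -> 'I_n}) (l : 'I_k) :
  'I_n * 'I_n := (x (widen_ord (leqnSn k) l), x (lift ord0 l)).

Definition is_walk (R : realType) (n N : nat) (G : tenetwork R n N) (k : nat)
    (x : {ffun 'I_k.+1 -> 'I_n}) (sg : {ffun 'I_k -> 'I_N}) : bool :=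
  [forall l : 'I_k, forall m : 'I_k, (l <= m)%N ==> (sg l <= sg m)%N]
  && [forall l : 'I_k, step x l \in edges (G (sg l))].

Definition walk_weight (R : realType) (n N : nat) (G : tenetwork R n N)
    (k : nat) (x : {ffun 'I_k.+1 -> 'I_n}) (sg : {ffun 'I_k -> 'I_N}) : R :=
  \prod_(l < k) weight (G (sg l)) (step x l).

Definition backtracking (n k : nat) (x : {ffun 'I_k.+1 -> 'I_n}) : bool :=
  [exists l : 'I_k.+1, exists m : 'I_k.+1, (m == l.+2 :> nat) && (x l == x m)].

Definition nbt (R : realType) (n N : nat) (G : tenetwork R n N) (k : nat) :
    'BM[R]_(n, N) :=
  match k with
  | 0 => 1%:M
  | k'.+1 => of_blk (fun tau1 tau2 => \matrix_(i, j)
      \sum_(w : {ffun 'I_k'.+2 -> 'I_n} * {ffun 'I_k'.+1 -> 'I_N} |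
          [&& is_walk G w.1 w.2, ~~ backtracking w.1,
              w.1 ord0 == i, w.1 ord_max == j,
              (tau1 <= w.2 ord0)%N & w.2 ord_max == tau2])
        walk_weight G w.1 w.2)
  end.

Definition psi_series (R : realType) (n N : nat) (G : tenetwork R n N) (t : R) :
  nat -> 'BM[R]_(n, N) := series (fun k => t ^+ k *: nbt G k).

Definition psi (R : realType) (n N : nat) (G : tenetwork R n N) (t : R) :
  'BM[R]_(n, N) := limn (psi_series G t).

(* The value V at t of a generating function that is rational, also when its
   series diverges at t: den * (\sum_k P_k 'X^k) = num as formal power series,
   and num / den has no pole at t. *)
Definition gen_value (R : realType) (m : nat) (P : nat -> 'M[R]_m) (t : R)
    (V : 'M[R]_m) : Prop :=
  exists (num : 'M[{poly R}]_m) (den : {poly R}),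
    [/\ den.[t] != 0,
        forall (k : nat) i j,
          (num i j)`_k = \sum_(l < k.+1) den`_l * P (k - l)%N i j
      & V = \matrix_(i, j) ((num i j).[t] / den.[t])].

Definition star (R : realType) (n N : nat) (A B : 'BM[R]_(n, N)) :
  'BM[R]_(n, N) :=
  of_blk (fun r s => \sum_(k < N) map2_mx *%R (blk A r k) (blk B k s)).

Definition star1 (R : realType) (n N : nat) : 'BM[R]_(n, N) :=
  of_blk (fun r s => if r == s then const_mx 1 else 0).

Definition is_star_inv (R : realType) (n N : nat) (M X : 'BM[R]_(n, N)) : Prop :=
  star M X = star1 R n N /\ star X M = star1 R n N.

(* Default value 0 when M is not invertible for [star]. *)
Definition star_inv (R : realType) (n N : nat) (M : 'BM[R]_(n, N)) :
  'BM[R]_(n, N) := xget 0 [set X | is_star_inv M X].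

Definition star_tr (R : realType) (n N : nat) (A : 'BM[R]_(n, N)) :
  'BM[R]_(n, N) := of_blk (fun r s => (blk A r s)^T).

Definition dd (R : realType) (n : nat) (X : 'M[R]_n) : 'M[R]_n :=
  \matrix_(i, j) if i == j then X i j else 0.

Definition star_dd (R : realType) (n N : nat) (A : 'BM[R]_(n, N)) :
  'BM[R]_(n, N) := of_blk (fun r s => dd (blk A r s)).

(* The entries of the adjacency matrices are nonnegative, so 0 is a neutral
   initial value for the maximum. *)
Definition t0 (R : realType) (n N : nat) (G : tenetwork R n N) : \bar R :=
  let m := \big[Num.max/0]_(p : 'I_n * 'I_n * 'I_N)
             (adj (G p.2) p.1.1 p.1.2 * adj (G p.2) p.1.2 p.1.1) in
  if m == 0 then +oo%E else (m `^ (- 2^-1))%:E.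

(* Main.v *)
Require Import Defs.
From HB Require Import structures.
From mathcomp Require Import all_boot all_order all_algebra.
From mathcomp Require Import all_classical all_reals all_analysis.
From mathcomp Require Import ring.

Set Implicit Arguments.
Unset Strict Implicit.
Unset Printing Implicit Defensive.
Import Order.TTheory GRing.Theory Num.Theory.
Import numFieldNormedType.Exports.

Local Open Scope classical_set_scope.
Local Open Scope ring_scope.

(** Fix two nodes i, j and keep, of every block of a block matrix, only the
    (i, j) entry: this leaves an N x N matrix over the time frames, called here
    the fiber over (i, j).  The product [star] is the matrix product fiber by
    fiber, while the ordinary product convolves the fibers over the nodes
    ([fiber_star], [fiberM]).  Write a_ij for the fiber of the time-evolving
    adjacency matrix: its entry (r, s) is the weight of (i, j) on frame s if
    r <= s and 0 otherwise, so that a product of such fibers along a sequence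
    of nodes adds up the weights over all nondecreasing choices of frames
    ([sum_frames]).  Hence the fiber of P_k over (h, j) is the sum of
    a_{x0 x1} ... a_{x(k-1) xk} over the nonbacktracking node sequences x of
    length k from h to j ([fiber_nbt]), and time disappears from the
    combinatorics.

    Let U_j be the generating function of these sums for a fixed start h, and
    V_ij its part made of the walks whose last step is i -> j.  Removing the
    last step leaves a walk to i that does not end with j -> i, whence
      V_ij = t (U_i - V_ji) a_ij,      U_j = delta_hj + sum_i V_ij.
    Substituting the first equation for V_ji into itself gives
      V_ij (1 - t^2 a_ji a_ij) = t U_i a_ij - t^2 U_j a_ji a_ij.
    With K_ij = t a_ij (1 - t^2 a_ji a_ij)^-1 this reads
    V_ij = U_i K_ij - U_j t a_ji K_ij, and summing over i yields
    Psi (I - K + dd(t A K)) = I ([nb_elimination]).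

    The computation is done with polynomials in 'X, modulo 'X^m for every m,
    where the inverse is replaced by a multiple of an adjugate, so that a common
    denominator q appears: P L = q as power series, with L a polynomial matrix
    and L(t) = q(t) M(t), M being the matrix to be inverted.  Each a_ij is
    triangular in time, so 1 - t^2 a_ji a_ij has determinant
    prod_s (1 - t^2 (A_s)_ij (A_s)_ji), which is positive below [t0]
    ([bt_factor_unit]); thus q(t) is nonzero there.  The formal identity passes
    to the sum of the series wherever it converges ([lim_formal_mul]), and to
    the value at t of any rational expression of it ([formal_mul_inj]); the
    adjugate of L provides such an expression whose only possible poles are the
    zeros of det L. *)

(** * Block matrices through their fibers *)

Definition fiber (S : Type) (n N : nat) (A : 'M[S]_(\sum_(_ < N) n)%N)
    (i j : 'I_n) : 'M[S]_N :=
  \matrix_(r, s) @submxblock S N N (fun=> n) (fun=> n) A r s i j.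

Definition of_fibers (S : Type) (n N : nat) (F : 'I_n -> 'I_n -> 'M[S]_N) :
    'M[S]_(\sum_(_ < N) n)%N :=
  \mxblock_(r < N, s < N) \matrix_(i < n, j < n) F i j r s.

Lemma of_fibersK (S : Type) (n N : nat) (F : 'I_n -> 'I_n -> 'M[S]_N) i j :
  fiber (of_fibers F) i j = F i j.
Proof. by apply/matrixP => r s; rewrite mxE mxblockK mxE. Qed.

Lemma fiber_inj (S : Type) (n N : nat) (A B : 'M[S]_(\sum_(_ < N) n)%N) :
  (forall i j, fiber A i j = fiber B i j) -> A = B.
Proof.
move=> eqAB; apply/(mxblockP (p_ := fun=> n) (q_ := fun=> n)) => r s.
apply/matrixP => i j.
by have /matrixP/(_ r s) := eqAB i j; rewrite !mxE.
Qed.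

Lemma fiberD (S : nmodType) (n N : nat) (A B : 'M[S]_(\sum_(_ < N) n)%N) i j :
  fiber (A + B) i j = fiber A i j + fiber B i j.
Proof. by apply/matrixP => r s; rewrite !mxE. Qed.

Lemma fiberN (S : zmodType) (n N : nat) (A : 'M[S]_(\sum_(_ < N) n)%N) i j :
  fiber (- A) i j = - fiber A i j.
Proof. by apply/matrixP => r s; rewrite !mxE. Qed.

Lemma fiberZ (S : pzRingType) (n N : nat) (c : S)
    (A : 'M[S]_(\sum_(_ < N) n)%N) i j :
  fiber (c *: A) i j = c *: fiber A i j.
Proof. by apply/matrixP => r s; rewrite !mxE. Qed.

Lemma fiber_scalar (S : pzRingType) (n N : nat) (c : S) (i j : 'I_n) :
  fiber (c%:M : 'M[S]_(\sum_(_ < N) n)%N) i j = if i == j then c%:M else 0.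
Proof.
apply/matrixP => r s; rewrite 3!mxE -val_eqE .
rewrite tagnat.eq_Rank.
have [->|rs] := eqVneq r s; have [->|ij] := eqVneq i j;
  by rewrite ?eqxx ?mxE ?eqxx ?(negPf rs) // val_eqE (negPf ij).
Qed.

(** Rows of the big matrix are pairs (frame, node): summing over the frame
    inside each term is what makes the fibers multiply as matrices. *)
Lemma fiberM (S : pzSemiRingType) (n N : nat)
    (A B : 'M[S]_(\sum_(_ < N) n)%N) i j :
  fiber (A *m B) i j = \sum_h fiber A i h *m fiber B h j.
Proof.
apply/matrixP => r s; rewrite mxE.
rewrite -[A in LHS](submxblockK (p_ := fun=> n) (q_ := fun=> n)).
rewrite -[B in LHS](submxblockK (p_ := fun=> n) (q_ := fun=> n)).
rewrite mul_mxblock mxblockK !summxE.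
under eq_bigr do rewrite mxE; rewrite exchange_big /=.
by apply: eq_bigr => h _; rewrite [RHS]mxE; apply: eq_bigr => k _; rewrite !mxE.
Qed.

Lemma fiber_of_blk (R : realType) (n N : nat) (B : 'I_N -> 'I_N -> 'M[R]_n)
    i j : fiber (of_blk B) i j = \matrix_(r, s) B r s i j.
Proof. by apply/matrixP => r s; rewrite [LHS]mxE [RHS]mxE mxblockK. Qed.

Lemma blk_fiber (R : realType) (n N : nat) (A : 'BM[R]_(n, N)) r s i j :
  blk A r s i j = fiber A i j r s.
Proof. by rewrite [RHS]mxE. Qed.

Lemma fiber_star (R : realType) (n N : nat) (A B : 'BM[R]_(n, N)) i j :
  fiber (star A B) i j = fiber A i j *m fiber B i j.
Proof.
rewrite fiber_of_blk; apply/matrixP => r s; rewrite [LHS]mxE [RHS]mxE summxE.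
by apply: eq_bigr => k _; rewrite mxE !blk_fiber.
Qed.

Lemma fiber_star1 (R : realType) (n N : nat) i j :
  fiber (star1 R n N) i j = 1%:M.
Proof.
rewrite fiber_of_blk; apply/matrixP => r s; rewrite !mxE.
by case: eqP => _; rewrite mxE.
Qed.

Lemma fiber_star_tr (R : realType) (n N : nat) (A : 'BM[R]_(n, N)) i j :
  fiber (star_tr A) i j = fiber A j i.
Proof.
by rewrite fiber_of_blk; apply/matrixP => r s; rewrite [LHS]mxE [LHS]mxE blk_fiber.
Qed.

Lemma fiber_star_dd (R : realType) (n N : nat) (A : 'BM[R]_(n, N)) i j :
  fiber (star_dd A) i j = if i == j then fiber A i j else 0.
Proof.
rewrite fiber_of_blk; apply/matrixP => r s; rewrite [LHS]mxE [LHS]mxE blk_fiber.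
by case: eqP => // _; rewrite [RHS]mxE.
Qed.

Lemma fiber_te_adj (R : realType) (n N : nat) (G : tenetwork R n N) i j :
  fiber (te_adj G) i j = \matrix_(r, s) if (r <= s)%N then adj (G s) i j else 0.
Proof.
rewrite fiber_of_blk; apply/matrixP => r s; rewrite !mxE.
by case: ifP => // _; rewrite mxE.
Qed.

(** Inversion for [star] decouples into n^2 independent inversions of N x N
    matrices. *)
Lemma is_star_invP (R : realType) (n N : nat) (A X : 'BM[R]_(n, N)) :
  is_star_inv A X <->
  forall i j, fiber A i j \in unitmx /\ fiber X i j = invmx (fiber A i j).
Proof.
split=> [[AX XA] i j|H].
  have/mulmx1_unit[uA _] : fiber A i j *m fiber X i j = 1%:M.
    by rewrite -fiber_star AX fiber_star1.
  split=> //; apply: (can_inj (mulKmx uA)).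
  by rewrite mulmxV // -fiber_star AX fiber_star1.
split; apply: fiber_inj => i j; have [uA eX] := H i j;
  by rewrite fiber_star fiber_star1 eX ?mulmxV ?mulVmx.
Qed.

(** * Nonbacktracking walks as sums of products of fibers *)

(** Walks are decomposed by their last step rather than by their first: this
    produces t a_ij (1 - t^2 a_ji a_ij)^-1 with the inverse on the right, as in
    the theorem. *)
Definition snoc (T : Type) (k : nat) (f : {ffun 'I_k -> T}) (y : T) :
  {ffun 'I_k.+1 -> T} := [ffun i => oapp f y (unlift ord_max i)].

Lemma snoc_last (T : Type) (k : nat) (f : {ffun 'I_k -> T}) y :
  snoc f y ord_max = y.
Proof. by rewrite ffunE unlift_none. Qed.

Lemma snoc_init (T : Type) (k : nat) (f : {ffun 'I_k -> T}) y
    (i : 'I_k.+1) (j : 'I_k) : i = j :> nat -> snoc f y i = f j.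
Proof.
move=> ij; suff -> : i = lift ord_max j by rewrite ffunE liftK.
by apply: val_inj; rewrite [RHS]lift_max.
Qed.

Lemma ord_maxVinit (k : nat) (i : 'I_k.+1) :
  i = ord_max \/ exists j : 'I_k, i = widen_ord (leqnSn k) j.
Proof.
case: (unliftP ord_max i) => [j ->|->]; [right; exists j | by left].
by apply: val_inj; rewrite [LHS]lift_max.
Qed.

Lemma big_snoc (V : nmodType) (T : finType) (k : nat)
    (F : {ffun 'I_k.+1 -> T} -> V) :
  \sum_f F f = \sum_(f : {ffun 'I_k -> T}) \sum_y F (snoc f y).
Proof.
rewrite pair_big /=.
rewrite (reindex (fun u : {ffun 'I_k -> T} * T => snoc u.1 u.2)) //=.
exists (fun f => ([ffun i => f (widen_ord (leqnSn k) i)], f ord_max)).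
  move=> [f y] _ /=; rewrite snoc_last; congr (_, y).
  by apply/ffunP => i; rewrite ffunE (snoc_init _ _ (j := i)).
move=> f _ /=; apply/ffunP => i; case: (ord_maxVinit i) => [->|[j ->]].
  by rewrite snoc_last.
by rewrite (snoc_init _ _ (j := j)) // ffunE.
Qed.

(** The part of [is_walk] that speaks of the frames only. *)
Definition nondec (k N : nat) (sg : {ffun 'I_k -> 'I_N}) : bool :=
  [forall l : 'I_k, forall m : 'I_k, (l <= m)%N ==> (sg l <= sg m)%N].

Lemma nondecP (k N : nat) (sg : {ffun 'I_k -> 'I_N}) :
  reflect (forall l m : 'I_k, (l <= m)%N -> (sg l <= sg m)%N) (nondec sg).
Proof.
apply: (iffP forallP) => [H l m|H l]; first by have /forallP/(_ m)/implyP := H l.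
by apply/forallP => m; apply/implyP/H.
Qed.

Lemma nondec_snoc (k N : nat) (sg : {ffun 'I_k.+1 -> 'I_N}) s :
  nondec (snoc sg s) = nondec sg && (sg ord_max <= s)%N.
Proof.
apply/nondecP/andP => [H|[/nondecP H ls] l m].
  split.
    apply/nondecP => l m lm.
    have := H (widen_ord (leqnSn _) l) (widen_ord (leqnSn _) m) lm.
    by rewrite (snoc_init _ _ (j := l)) // (snoc_init _ _ (j := m)).
  have := H (widen_ord (leqnSn _) ord_max) ord_max (leqnSn _).
  by rewrite (snoc_init _ _ (j := ord_max)) // snoc_last.
case: (ord_maxVinit m) => [->|[m' ->]]; case: (ord_maxVinit l) => [->|[l' ->]].
- by [].
- rewrite snoc_last (snoc_init _ _ (j := l')) // => _.
  by apply: leq_trans ls; apply: H; rewrite -ltnS.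
- by rewrite /= leqNgt ltn_ord.
- by rewrite (snoc_init _ _ (j := l')) // (snoc_init _ _ (j := m')) //; apply: H.
Qed.

(** The step matrices are upper triangular: the entry (r', s') is the weight of
    the step on frame s', provided that the walk was on frame r' <= s' before.
    Expanding the product thus enumerates the nondecreasing sequences of
    frames; the row index r is the earliest frame allowed for the first step. *)
Lemma sum_frames (R : pzRingType) (k N : nat) (b : 'I_k.+1 -> 'I_N -> R)
    (r s : 'I_N) :
  \sum_(sg : {ffun 'I_k.+1 -> 'I_N} |
      [&& nondec sg, (r <= sg ord0)%N & sg ord_max == s])
    \prod_(l < k.+1) b l (sg l) =
  (\prod_(l < k.+1)
     \matrix_(r', s') if (r' <= s')%N then b l s' else 0) r s.
Proof.
elim: k b s => [|k IH] b s.
  rewrite big_ord1 mxE big_mkcond /= big_snoc.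
  have e0 : all_equal_to [ffun i : 'I_0 => r] by move=> g; apply/ffunP => - [].
  rewrite (big_pred1 [ffun i : 'I_0 => r]); last by move=> g; rewrite /= (e0 g) eqxx.
  have nd y : nondec (snoc [ffun i : 'I_0 => r] y).
    by apply/nondecP => l m _; rewrite (ord1 l) (ord1 m).
  rewrite (bigD1 s) //= [X in _ + X]big1 => [|y ys].
    rewrite addr0 nd big_ord1; have <- : ord_max = ord0 :> 'I_1 by apply: val_inj.
    by rewrite snoc_last eqxx andbT.
  by rewrite snoc_last (negPf ys) !andbF.
rewrite [in RHS]big_ord_recr /= -mulmxE mxE big_mkcond /= big_snoc.
under [RHS]eq_bigr => s2 _.
  rewrite -IH mxE big_mkcond mulr_suml; over.
rewrite /= [RHS]exchange_big /=; apply: eq_bigr => g _.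
(* Only the last frame s, and the intermediate frame g ord_max, contribute. *)
rewrite (bigD1 s) //= [X in _ + X]big1 => [|y ys]; last first.
  by rewrite snoc_last (negPf ys) !andbF.
rewrite addr0 (bigD1 (g ord_max)) //= [X in _ = _ + X]big1 => [|y ys]; last first.
  by rewrite (eq_sym _ y) (negPf ys) !andbF mul0r.
rewrite addr0 snoc_last !eqxx !andbT nondec_snoc (snoc_init _ _ (j := ord0)) //.
case: (nondec g) => /=; last by rewrite mul0r.
case: (r <= _)%N => /=; last by rewrite andbF mul0r.
rewrite andbT; case: (_ <= s)%N => /=; last by rewrite mulr0.
rewrite big_ord_recr /= snoc_last; congr (_ * _).
by apply: eq_bigr => l _; rewrite (snoc_init _ _ (j := l)).
Qed.

Definition path_prod (R : pzRingType) (n N k : nat)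
    (a : 'I_n -> 'I_n -> 'M[R]_N) (x : {ffun 'I_k.+1 -> 'I_n}) : 'M[R]_N :=
  \prod_(l < k) a (step x l).1 (step x l).2.

Lemma path_prod_snoc (R : pzRingType) (n N k : nat)
    (a : 'I_n -> 'I_n -> 'M[R]_N) (x : {ffun 'I_k.+1 -> 'I_n}) y :
  path_prod a (snoc x y) = path_prod a x *m a (x ord_max) y.
Proof.
rewrite /path_prod big_ord_recr /= -mulmxE (snoc_init _ _ (j := ord_max)) //.
have -> : lift ord0 ord_max = ord_max :> 'I_k.+2 by apply: val_inj.
rewrite snoc_last; congr (_ *m _); apply: eq_bigr => l _.
by rewrite (snoc_init _ _ (j := widen_ord (leqnSn k) l)) //
           (snoc_init _ _ (j := lift ord0 l)).
Qed.

(** Appending a node creates only one new pair of positions at distance two. *)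
Lemma backtracking_snoc (n k : nat) (x : {ffun 'I_k.+2 -> 'I_n}) y :
  backtracking (snoc x y) =
  backtracking x || (x (widen_ord (leqnSn _) ord_max) == y).
Proof.
apply/idP/idP => [/existsP[l /existsP[m /andP[/eqP ml]]]|/orP[]].
- case: (ord_maxVinit m) ml => [->|[m' ->]] /= ml.
    rewrite snoc_last (snoc_init _ _ (j := widen_ord (leqnSn _) ord_max)).
      by move=> ->; rewrite orbT.
    by case: ml.
  have lk : (l < k.+2)%N by have := ltn_ord m'; rewrite ml => /ltnW/ltnW.
  rewrite (snoc_init _ _ (j := Ordinal lk)) // (snoc_init _ _ (j := m')) // => e.
  apply/orP; left; apply/existsP; exists (Ordinal lk); apply/existsP; exists m'.
  by rewrite e andbT /= ml.
- move=> /existsP[l /existsP[m /andP[/eqP ml e]]].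
  apply/existsP; exists (widen_ord (leqnSn _) l).
  apply/existsP; exists (widen_ord (leqnSn _) m).
  by rewrite (snoc_init _ _ (j := l)) // (snoc_init _ _ (j := m)) // e andbT /= ml.
- move=> e; apply/existsP.
  exists (widen_ord (leqnSn _) (widen_ord (leqnSn _) ord_max)).
  apply/existsP; exists ord_max; rewrite eqxx /= snoc_last.
  by rewrite (snoc_init _ _ (j := widen_ord (leqnSn _) ord_max)).
Qed.

Definition nbsum (R : pzRingType) (n N : nat) (a : 'I_n -> 'I_n -> 'M[R]_N)
    (k : nat) (h j : 'I_n) : 'M[R]_N :=
  \sum_(x : {ffun 'I_k.+1 -> 'I_n} |
      [&& ~~ backtracking x, x ord0 == h & x ord_max == j]) path_prod a x.

(** The value 0 at length 0 (no last step) makes the recursion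
    [nbsum_lastS] hold from the first step on. *)
Definition nbsum_last (R : pzRingType) (n N : nat)
    (a : 'I_n -> 'I_n -> 'M[R]_N) (k : nat) (h i j : 'I_n) : 'M[R]_N :=
  if k is k'.+1 then
    \sum_(x : {ffun 'I_k'.+2 -> 'I_n} |
        [&& ~~ backtracking x, x ord0 == h,
            x (widen_ord (leqnSn _) ord_max) == i & x ord_max == j])
      path_prod a x
  else 0.

Lemma backtracking_short (n k : nat) (x : {ffun 'I_k.+1 -> 'I_n}) :
  (k < 2)%N -> backtracking x = false.
Proof.
move=> k2; apply/existsP => - [l /existsP[m /andP[/eqP ml _]]].
by have := leq_trans (ltn_ord m) k2; rewrite ml.
Qed.

Lemma nbsum0 (R : pzRingType) (n N : nat) (a : 'I_n -> 'I_n -> 'M[R]_N) h j :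
  nbsum a 0 h j = if h == j then 1%:M else 0.
Proof.
have e0 : ord_max = ord0 :> 'I_1 by apply: val_inj.
rewrite /nbsum e0; have [<-|hj] := eqVneq h j; last first.
  apply: big_pred0 => x; rewrite backtracking_short //=.
  by apply/andP => - [/eqP-> /eqP e]; rewrite e eqxx in hj.
rewrite (big_pred1 [ffun=> h]) => [|x]; first by rewrite /path_prod big_ord0.
rewrite backtracking_short //= andbb; apply/eqP/eqP => [<-|->]; last by rewrite ffunE.
by apply/ffunP => i; rewrite ffunE (ord1 i).
Qed.

Lemma nbsumS (R : pzRingType) (n N : nat) (a : 'I_n -> 'I_n -> 'M[R]_N) k h j :
  nbsum a k.+1 h j = \sum_i nbsum_last a k.+1 h i j.
Proof.
rewrite /nbsum (partition_big (fun x : {ffun 'I_k.+2 -> 'I_n} =>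
  x (widen_ord (leqnSn _) ord_max)) predT) //=.
apply: eq_bigr => i _; apply: eq_bigl => x.
by rewrite -!andbA; congr [&& _, _ & _]; rewrite andbC.
Qed.

(** The walk that remains after removing the step i -> j ends at i, and it may
    be any nonbacktracking walk except those whose last step is j -> i. *)
Lemma nbsum_lastS (R : pzRingType) (n N : nat) (a : 'I_n -> 'I_n -> 'M[R]_N)
    k h i j :
  nbsum_last a k.+1 h i j = (nbsum a k h i - nbsum_last a k h j i) *m a i j.
Proof.
rewrite /= big_mkcond big_snoc /=.
under eq_bigr => x _.
  rewrite (bigD1 j) //= big1 => [|y yj]; last first.
    by rewrite snoc_last (negPf yj) !andbF.
  rewrite addr0 snoc_last eqxx andbT path_prod_snoc.
  rewrite (snoc_init _ _ (j := ord0)) // (snoc_init _ _ (j := ord_max)) //.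
  over.
rewrite /= -big_mkcond /=.
under eq_bigr => x /and3P[_ _ /eqP ->] do over.
rewrite -mulmx_suml; congr (_ *m _).
case: k => [|k] /=.
  rewrite subr0; apply: eq_bigl => x.
  by rewrite !backtracking_short.
rewrite /nbsum [in RHS](bigID (fun x : {ffun 'I_k.+2 -> 'I_n} =>
  x (widen_ord (leqnSn _) ord_max) == j)) /= addrAC.
rewrite [X in X - _](_ : _ = \sum_(x : {ffun 'I_k.+2 -> 'I_n} |
   [&& ~~ backtracking x, x ord0 == h, x (widen_ord (leqnSn _) ord_max) == j
     & x ord_max == i]) path_prod a x); last first.
  apply: eq_bigl => x; rewrite -!andbA; congr [&& _, _ & _]; exact: andbC.
rewrite subrr add0r; apply: eq_bigl => x; rewrite backtracking_snoc negb_or.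
rewrite -!andbA; congr (_ && _); rewrite andbC -andbA //.
Qed.

(** Since [adj] vanishes off the edges, the edge condition of [is_walk] can be
    absorbed in the weight. *)
Lemma prod_adj (R : realType) (n N : nat) (G : tenetwork R n N) (k : nat)
    (x : {ffun 'I_k.+1 -> 'I_n}) (sg : {ffun 'I_k -> 'I_N}) :
  \prod_(l < k) adj (G (sg l)) (step x l).1 (step x l).2 =
  if [forall l : 'I_k, step x l \in edges (G (sg l))]
  then walk_weight G x sg else 0.
Proof.
case: ifPn => [/forallP xE|].
  by apply: eq_bigr => l _; rewrite mxE -surjective_pairing xE.
rewrite negb_forall => /existsP[l xl]; apply/eqP/prodf_eq0; exists l => //.
by rewrite mxE -surjective_pairing (negPf xl).
Qed.

(** Backtracking depends on the nodes only, so for each node sequence the sum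
    over the frames is a product of fibers, by [sum_frames]. *)
Lemma fiber_nbt (R : realType) (n N : nat) (G : tenetwork R n N) k i j :
  fiber (nbt G k) i j = nbsum (fiber (te_adj G)) k i j.
Proof.
case: k => [|k]; first by rewrite nbsum0 [nbt _ _]/= fiber_scalar.
rewrite fiber_of_blk; apply/matrixP => r s; rewrite mxE [LHS]mxE /nbsum summxE.
rewrite big_mkcond [RHS]big_mkcond /=.
rewrite -(pair_bigA _ (fun x sg => if [&& is_walk G x sg, ~~ backtracking x,
  x ord0 == i, x ord_max == j, (r <= sg ord0)%N & sg ord_max == s]
  then walk_weight G x sg else 0)) /=.
apply: eq_bigr => x _; case: ifPn => [/and3P[nb xi xj]|nb]; last first.
  apply: big1 => sg _; case: ifP => // /and5P[_ h1 h2 h3 _].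
  by rewrite h1 h2 h3 in nb.
have -> : path_prod (fiber (te_adj G)) x = \prod_(l < k.+1)
    \matrix_(r', s') if (r' <= s')%N then
      adj (G s') (step x l).1 (step x l).2 else 0.
  by apply: eq_bigr => l _; rewrite fiber_te_adj.
rewrite -sum_frames [RHS]big_mkcond /=; apply: eq_bigr => sg _.
rewrite nb xi xj prod_adj /is_walk -/(nondec sg) /= -!andbA.
by case: (nondec sg); case: [forall l, _]; rewrite //= if_same.
Qed.

(** * Power series times polynomial matrices *)

Definition eqmodX (R : nzRingType) (d e m : nat) (A B : 'M[{poly R}]_(d, e)) :=
  forall k i j, (k < m)%N -> (A i j)`_k = (B i j)`_k.

Lemma eqmodX_mulr (R : nzRingType) (d e f m : nat) (A B : 'M[{poly R}]_(d, e))
    (C : 'M[{poly R}]_(e, f)) : eqmodX m A B -> eqmodX m (A *m C) (B *m C).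
Proof.
move=> AB k i j km; rewrite !mxE !coef_sum; apply: eq_bigr => h _.
rewrite !coefM; apply: eq_bigr => l _; rewrite AB //.
exact: leq_ltn_trans (leq_ord l) km.
Qed.

Lemma eqmodX_addX (R : nzRingType) (d e m : nat) (A E : 'M[{poly R}]_(d, e)) :
  eqmodX m (A + 'X^m *: E) A.
Proof. by move=> k i j km; rewrite !mxE coefD coefXnM km addr0. Qed.

Lemma eqmodX_eq (R : nzRingType) (d e : nat) (A B : 'M[{poly R}]_(d, e)) :
  (forall m, eqmodX m A B) -> A = B.
Proof. by move=> AB; apply/matrixP => i j; apply/polyP => k; apply: (AB k.+1). Qed.

Definition trunc (R : nzRingType) (d e m : nat) (P : nat -> 'M[R]_(d, e)) :
    'M[{poly R}]_(d, e) := \matrix_(i, j) \poly_(k < m) P k i j.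

(** The identity (sum_k P_k 'X^k) B = Q of formal power series, for polynomial
    matrices B and Q. *)
Definition formal_mul (R : nzRingType) (d e f : nat) (P : nat -> 'M[R]_(d, e))
    (B : 'M[{poly R}]_(e, f)) (Q : 'M[{poly R}]_(d, f)) :=
  forall m, eqmodX m (trunc m P *m B) Q.

Lemma formal_mul_coef (R : nzRingType) (d e f : nat) (P : nat -> 'M[R]_(d, e))
    (B : 'M[{poly R}]_(e, f)) (Q : 'M[{poly R}]_(d, f)) :
  formal_mul P B Q <->
  forall k i j,
    (Q i j)`_k = \sum_h \sum_(l < k.+1) P (k - l)%N i h * (B h j)`_l.
Proof.
have coefPB m k i j : (k < m)%N ->
    ((trunc m P *m B) i j)`_k =
    \sum_h \sum_(l < k.+1) P (k - l)%N i h * (B h j)`_l.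
  move=> km; rewrite mxE coef_sum; apply: eq_bigr => h _; rewrite coefMr.
  apply: eq_bigr => l _; rewrite mxE coef_poly ifT //.
  exact: leq_ltn_trans (leq_subr _ _) km.
split=> [PB k i j|PB m k i j km]; last by rewrite coefPB.
by rewrite -(PB k.+1) // coefPB.
Qed.

Lemma formal_mul_mulr (R : nzRingType) (d e f g : nat)
    (P : nat -> 'M[R]_(d, e)) (B : 'M[{poly R}]_(e, f))
    (Q : 'M[{poly R}]_(d, f)) (C : 'M[{poly R}]_(f, g)) :
  formal_mul P B Q -> formal_mul P (B *m C) (Q *m C).
Proof. by move=> PB m; rewrite mulmxA; apply/eqmodX_mulr/PB. Qed.

(** Two polynomials that agree modulo every power of 'X are equal. *)
Lemma formal_mul_inj (R : nzRingType) (d e f : nat)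
    (P : nat -> 'M[R]_(d, e)) (B : 'M[{poly R}]_(e, f))
    (Q Q' : 'M[{poly R}]_(d, f)) :
  formal_mul P B Q -> formal_mul P B Q' -> Q = Q'.
Proof.
by move=> PQ PQ'; apply: eqmodX_eq => m k i j km; rewrite -(PQ m) // -(PQ' m).
Qed.

(** [gen_value] is an instance of [formal_mul], with a scalar matrix as the
    polynomial factor. *)
Lemma gen_valueP (R : realType) (d : nat) (P : nat -> 'M[R]_d) (t : R)
    (V : 'M[R]_d) :
  gen_value P t V <->
  exists (num : 'M[{poly R}]_d) (den : {poly R}),
    [/\ den.[t] != 0, formal_mul P den%:M num &
        den.[t] *: V = map_mx (horner_eval t) num].
Proof.
have rowE (den : {poly R}) k (i j : 'I_d) :
    \sum_h \sum_(l < k.+1) P (k - l)%N i h * ((den%:M : 'M[{poly R}]_d) h j)`_l =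
    \sum_(l < k.+1) den`_l * P (k - l)%N i j.
  rewrite (bigD1 j) //= [X in _ + X]big1 => [|h hj].
    by rewrite addr0; apply: eq_bigr => l _; rewrite mxE eqxx mulr1n mulrC.
  by apply: big1 => l _; rewrite mxE (negPf hj) coef0 mulr0.
split=> - [num [den [d0 PE VE]]]; exists num, den; split=> //.
- by apply/formal_mul_coef => k i j; rewrite rowE.
- by apply/matrixP => i j; rewrite VE !mxE mulrC divfK.
- by move=> k i j; rewrite -rowE; apply: (formal_mul_coef P _ num).1.
- apply/matrixP => i j; have /matrixP/(_ i j) := VE.
  by rewrite !mxE /horner_eval => <-; rewrite mulrC mulKf.
Qed.

(** A polynomial factor is harmless for convergence: by Horner's scheme,
    multiplying by b * 'X + c amounts to shifting the partial sums of the
    product by b and adding c times those of p.  In particular absolute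
    convergence is not involved. *)
Lemma cvg_formal_mul (R : realType) (p : nat -> R) (b : {poly R}) (t s : R) :
  (fun m => \sum_(k < m) t ^+ k * p k) @ \oo --> s ->
  (fun m => \sum_(k < m) t ^+ k * \sum_(l < k.+1) p (k - l)%N * b`_l) @ \oo
    --> s * b.[t].
Proof.
move=> ps; elim/poly_ind: b => [|b c IH].
  rewrite horner0 mulr0 [X in X @ _](_ : _ = fun=> 0); first exact: cvg_cst.
  apply/funext => m; apply: big1 => k _.
  by rewrite big1 ?mulr0 // => l _; rewrite coef0 mulr0.
rewrite hornerMXaddC -cvg_shiftS /=.
rewrite [X in X @ _](_ : _ = fun m => t *
    (\sum_(k < m) t ^+ k * \sum_(l < k.+1) p (k - l)%N * b`_l) +
    (\sum_(k < m.+1) t ^+ k * p k) * c); last first.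
  apply/funext => m; rewrite mulr_suml.
  under eq_bigr => k _.
    rewrite big_ord_recl subn0 coefD coefMX coefC /= add0r mulrDr mulrA addrC.
    over.
  rewrite /= big_split /=; congr (_ + _).
  rewrite big_ord_recl big_ord0 mulr0 add0r.
  rewrite mulr_sumr; apply: eq_bigr => k _; rewrite exprS -mulrA.
  congr (_ * (_ * _)); apply: eq_bigr => l _.
  by rewrite coefD coefMX coefC /= addr0 subSS.
rewrite mulrDr mulrA [_ * t]mulrC; apply: cvgD; first exact: cvgMl_tmp.
by apply: cvgMr_tmp; rewrite (cvg_shiftS (fun m => \sum_(k < m) t ^+ k * p k)).
Qed.

(** The topology on matrices is the product topology. *)
Lemma cvg_mxP (R : realType) (d e : nat) (u : nat -> 'M[R]_(d, e))
    (U : 'M[R]_(d, e)) :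
  u @ \oo --> U <-> forall i j, (fun m => u m i j) @ \oo --> U i j.
Proof.
split=> [uU i j|uU].
  exact: (cvg_comp _ _ uU (@coord_continuous R d e i j U)).
move=> A [P nbP sPA]; rewrite nbhs_simpl; near=> m; apply: sPA => i j.
move: i j; near: m; apply: filter_forall => i; apply: filter_forall => j.
exact: uU (nbP i j).
Unshelve. all: by end_near.
Qed.

(** Both sides are limits of the partial sums of Q at t, which are eventually
    constant, Q being a polynomial. *)
Lemma lim_formal_mul (R : realType) (d e f : nat) (P : nat -> 'M[R]_(d, e))
    (B : 'M[{poly R}]_(e, f)) (Q : 'M[{poly R}]_(d, f)) (t : R) :
  formal_mul P B Q -> cvgn (series (fun k => t ^+ k *: P k)) ->
  limn (series (fun k => t ^+ k *: P k)) *m map_mx (horner_eval t) B =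
  map_mx (horner_eval t) Q.
Proof.
move=> /formal_mul_coef PB; set u := series _ => /cvg_mxP cu.
apply/matrixP => i j; rewrite !mxE /horner_eval.
set q := fun m => \sum_(k < m) t ^+ k * (Q i j)`_k.
have q1 : q @ \oo --> (Q i j).[t].
  apply: cvg_near_cst; exists (size (Q i j)) => // m /= Qm.
  by rewrite (horner_coef_wide t Qm); apply: eq_bigr => k _; rewrite mulrC.
have q2 : q @ \oo --> \sum_h (limn u) i h * (B h j).[t].
  rewrite [q](_ : _ = fun m => \sum_h \sum_(k < m) t ^+ k *
      \sum_(l < k.+1) P (k - l)%N i h * (B h j)`_l); last first.
    apply/funext => m; rewrite exchange_big /=; apply: eq_bigr => k _.
    by rewrite PB mulr_sumr.
  apply: cvg_big => [|h _]; first exact: add_continuous.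
  apply: (@cvg_formal_mul _ (fun k => P k i h)).
  rewrite [X in X @ _](_ : _ = fun m => u m i h).
    exact: cu.
  apply/funext => m; rewrite /u /series /= big_mkord summxE.
  by apply: eq_bigr => k _; rewrite mxE.
under eq_bigr do rewrite mxE /=.
exact: (cvg_unique _ q2 q1).
Qed.

(** * Elimination of the walks with a prescribed last step *)

(** The equations V_ij = x (U_i - V_ji) a_ij and U_j = d_j + sum_i V_ij are
    linear and couple V_ij with V_ji only; eliminating V leaves an equation in
    U.  The matrices C stand for q (1 - x^2 a_ji a_ij)^-1, and c E is an error
    term, c being a power of 'X for truncated series. *)
Lemma nb_elimination (S : comNzRingType) (n N : nat) (x c q : S)
    (a C : 'I_n -> 'I_n -> 'M[S]_N) (U d : 'I_n -> 'M[S]_N)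
    (V E : 'I_n -> 'I_n -> 'M[S]_N) :
  (forall i j, (1%:M - x ^+ 2 *: (a j i *m a i j)) *m C i j = q%:M) ->
  (forall i j, V i j = x *: ((U i - V j i) *m a i j) + c *: E i j) ->
  (forall j, U j = d j + \sum_i V i j) ->
  forall j, exists F, let kap i j := x *: (a i j *m C i j) in
    q *: U j + U j *m (\sum_i x *: (a j i *m kap i j)) - \sum_i U i *m kap i j =
    q *: d j + c *: F.
Proof.
move=> BC Vrec UE j.
(* Replacing V j i by its own equation closes the system in V i j. *)
have VB i : V i j *m (1%:M - x ^+ 2 *: (a j i *m a i j)) =
    x *: (U i *m a i j) - x ^+ 2 *: (U j *m (a j i *m a i j)) +
    c *: (E i j - x *: (E j i *m a i j)).
  have zA : x *: (V j i *m a i j) = x ^+ 2 *: (U j *m (a j i *m a i j)) -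
      x ^+ 2 *: (V i j *m (a j i *m a i j)) + c *: (x *: (E j i *m a i j)).
    rewrite (Vrec j i) mulmxDl -!scalemxAl !mulmxBl !mulmxA.
    by rewrite scalerDr !scalerBr !scalerA -expr2 (mulrC x c).
  rewrite mulmxBr mulmx1 -scalemxAr {1}Vrec mulmxBl scalerBr zA scalerBr.
  have abel (p r u v w : 'M[S]_N) : p - (r - u + v) + w - u = p - r + (w - v).
    by apply/matrixP => k l; rewrite !mxE; ring.
  exact: abel.
have qV i : q *: V i j =
    U i *m (x *: (a i j *m C i j)) -
    U j *m (x *: (a j i *m (x *: (a i j *m C i j)))) +
    c *: ((E i j - x *: (E j i *m a i j)) *m C i j).
  rewrite -mul_mx_scalar -(BC i j) mulmxA VB mulmxDl -scalemxAl mulmxBl.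
  by rewrite -!scalemxAl -!scalemxAr !mulmxA scalerA expr2.
exists (\sum_i (E i j - x *: (E j i *m a i j)) *m C i j) => /=.
rewrite {1}UE scalerDr scaler_sumr; rewrite (eq_bigr _ (fun i _ => qV i)).
rewrite !big_split /= sumrN -mulmx_sumr [in RHS]scaler_sumr.
have abel (p r u v : 'M[S]_N) : p + (r - u + v) + u - r = p + v.
  by apply/matrixP => k l; rewrite !mxE; ring.
exact: abel.
Qed.

Definition pmx (R : nzRingType) (N : nat) (A : 'M[R]_N) : 'M[{poly R}]_N :=
  map_mx polyC A.

(** The truncation at m of the right-hand side has one term too many, of degree
    m, which the last summand takes away. *)
Lemma trunc_nbsum_last (R : comNzRingType) (n N : nat)
    (a : 'I_n -> 'I_n -> 'M[R]_N) (m : nat) h i j :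
  trunc m (fun k => nbsum_last a k h i j) =
  'X *: ((trunc m (fun k => nbsum a k h i) -
          trunc m (fun k => nbsum_last a k h j i)) *m pmx (a i j)) +
  'X^m *: - pmx (nbsum_last a m h i j).
Proof.
apply/matrixP => r s; apply/polyP => k; rewrite !mxE coef_poly.
rewrite coefD coefXM coefXnM coefN coefC coef_sum.
case: k => [|k] /=.
  by case: m => [|m] /=; rewrite !mxE ?oppr0 addr0.
have -> : (\sum_(l < N) ((trunc m (fun k => nbsum a k h i) -
          trunc m (fun k => nbsum_last a k h j i)) r l * pmx (a i j) l s)`_k) =
   if (k < m)%N then nbsum_last a k.+1 h i j r s else 0.
  rewrite nbsum_lastS mxE; case: ifP => km.
    by apply: eq_bigr => l _; rewrite !mxE coefMC coefB !coef_poly km.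
  by apply: big1 => l _; rewrite !mxE coefMC coefB !coef_poly km subrr mul0r.
case: (ltngtP k.+1 m) => [km|mk|<-].
- by rewrite addr0.
- by rewrite subn_eq0 leqNgt mk subr0.
- by rewrite subnn subrr.
Qed.

Lemma trunc_nbsum (R : comNzRingType) (n N : nat)
    (a : 'I_n -> 'I_n -> 'M[R]_N) (m : nat) h j : (0 < m)%N ->
  trunc m (fun k => nbsum a k h j) =
  (if h == j then 1%:M else 0) +
  \sum_i trunc m (fun k => nbsum_last a k h i j).
Proof.
move=> m0; apply/matrixP => r s; apply/polyP => k.
rewrite !mxE coef_poly coefD [in RHS]summxE coef_sum.
under [in RHS]eq_bigr do rewrite mxE coef_poly.
case: k => [|k]; last first.
  rewrite nbsumS summxE [X in X + _](_ : _ = 0); last first.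
    by case: (h == j); rewrite !mxE ?coef0 // coefMn coef1 mul0rn.
  by rewrite add0r; case: ifP => // _; rewrite big1.
rewrite m0 nbsum0 big1 => [|i _]; last by rewrite mxE.
by rewrite addr0; case: (h == j); rewrite !mxE ?coef0 // coefMn coef1.
Qed.

Definition bt_factor (S : comNzRingType) (n N : nat) (x : S)
    (a : 'I_n -> 'I_n -> 'M[S]_N) (i j : 'I_n) : 'M[S]_N :=
  1%:M - x ^+ 2 *: (a j i *m a i j).

(** A common multiple of all the determinants of [bt_factor], so that the
    inverses of these matrices have a single denominator. *)
Definition den_poly (S : comNzRingType) (n N : nat) (x : S)
    (a : 'I_n -> 'I_n -> 'M[S]_N) : S :=
  \prod_(u : 'I_n * 'I_n) \det (bt_factor x a u.1 u.2).

(** The inverse of [bt_factor] times [den_poly], written without division so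
    that it makes sense over polynomials. *)
Definition bt_coinv (S : comNzRingType) (n N : nat) (x : S)
    (a : 'I_n -> 'I_n -> 'M[S]_N) (i j : 'I_n) : 'M[S]_N :=
  (\prod_(u : 'I_n * 'I_n | u != (i, j)) \det (bt_factor x a u.1 u.2)) *:
  \adj (bt_factor x a i j).

Lemma bt_coinvE (S : comNzRingType) (n N : nat) (x : S)
    (a : 'I_n -> 'I_n -> 'M[S]_N) (i j : 'I_n) :
  bt_factor x a i j *m bt_coinv x a i j = (den_poly x a)%:M.
Proof.
rewrite -scalemxAr mul_mx_adj scale_scalar_mx /den_poly [in RHS](bigD1 (i, j)) //=.
by congr (_%:M); exact: mulrC.
Qed.

(** This is q (I - K + dd(x A K)) for K_ij = x a_ij (C_ij / q): the matrix to
    be inverted, cleared of its denominator q.  For q = 1 and C the true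
    inverses it is the bracket of the theorem. *)
Definition deformed_laplacian (S : comNzRingType) (n N : nat) (x q : S)
    (a C : 'I_n -> 'I_n -> 'M[S]_N) : 'M[S]_(\sum_(_ < N) n)%N :=
  of_fibers (fun i j =>
    (if i == j
     then q%:M + \sum_h x *: (a i h *m (x *: (a h i *m C h i))) else 0) -
    x *: (a i j *m C i j)).

Lemma eqmodX_fiber (R : nzRingType) (n N m : nat)
    (A B : 'M[{poly R}]_(\sum_(_ < N) n)%N) :
  (forall i j, eqmodX m (fiber A i j) (fiber B i j)) -> eqmodX m A B.
Proof.
move=> AB k x y km.
have := AB (tagnat.sig2 x) (tagnat.sig2 y) k (tagnat.sig1 x) (tagnat.sig1 y) km.
by rewrite !mxE !tagnat.sig2K.
Qed.

Lemma fiber_trunc (R : nzRingType) (n N m : nat)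
    (P : nat -> 'M[R]_(\sum_(_ < N) n)%N) i j :
  fiber (trunc m P) i j = trunc m (fun k => fiber (P k) i j).
Proof.
apply/matrixP => r s; rewrite !mxE; apply/polyP => k.
by rewrite !coef_poly; case: ifP => // _; rewrite !mxE.
Qed.

(** The generating function of the nonbacktracking walks times the polynomial
    bracket is q.  The case m = 0 is apart since the term [nbsum0] of degree 0
    has to be present in the truncation. *)
Lemma formal_mul_nbt (R : realType) (n N : nat) (G : tenetwork R n N)
    (C : 'I_n -> 'I_n -> 'M[{poly R}]_N) (q : {poly R}) :
  let a i j := pmx (fiber (te_adj G) i j) in
  (forall i j, bt_factor 'X a i j *m C i j = q%:M) ->
  formal_mul (nbt G) (deformed_laplacian 'X q a C) q%:M.
Proof.
move=> a BC m; apply: eqmodX_fiber => h j.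
case: m => [|m]; first by [].
rewrite fiberM fiber_scalar.
pose U i := trunc m.+1 (fun k => nbsum (fiber (te_adj G)) k h i).
have Urec (i : 'I_n) : U i = (if h == i then 1%:M else 0) +
    \sum_g trunc m.+1 (fun k => nbsum_last (fiber (te_adj G)) k h g i).
  exact: trunc_nbsum.
have [F FE] := nb_elimination BC (@trunc_nbsum_last _ _ _ _ m.+1 h) Urec j.
have -> : \sum_i fiber (trunc m.+1 (nbt G)) h i *m
    fiber (deformed_laplacian 'X q a C) i j =
    (if h == j then q%:M else 0) + 'X^(m.+1) *: F.
  transitivity (q *: (if h == j then 1%:M else 0) + 'X^(m.+1) *: F); last first.
    by case: (h == j); rewrite ?scaler0 // scalemx1.
  rewrite -{}FE.
  under eq_bigr => i _.
    rewrite fiber_trunc of_fibersK.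
    rewrite (_ : trunc _ _ = U i); last first.
      by congr trunc; apply/funext => k; rewrite fiber_nbt.
    rewrite mulmxBr; over.
  rewrite /= sumrB; congr (_ - _).
  rewrite (bigD1 j) //= eqxx [X in _ + X]big1 ?addr0 => [|i ij]; last first.
    by rewrite (negPf ij) mulmx0.
  by rewrite mulmxDr mul_mx_scalar.
exact: eqmodX_addX.
Qed.

(** * Evaluation below the threshold *)

Lemma adj_ge0 (R : realType) (n : nat) (H : wdigraph R n) i j :
  0 <= adj H i j.
Proof. by rewrite mxE; case: ifP => // /weight_gt0/ltW. Qed.

Lemma lt_t0 (R : realType) (n N : nat) (G : tenetwork R n N) (t : R) i j s :
  0 < t -> (t%:E < t0 G)%E -> t ^+ 2 * (adj (G s) i j * adj (G s) j i) < 1.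
Proof.
move=> t_gt0; rewrite /t0; set m := \big[Num.max/0]_p _.
have le_m : adj (G s) i j * adj (G s) j i <= m.
  exact: (le_bigmax _ (fun p : 'I_n * 'I_n * 'I_N =>
    adj (G p.2) p.1.1 p.1.2 * adj (G p.2) p.1.2 p.1.1) (i, j, s)).
have m_ge0 : 0 <= m by apply: le_trans le_m; rewrite mulr_ge0 ?adj_ge0.
case: eqP => [m0 _|/eqP m0].
  apply: le_lt_trans ltr01; rewrite mulr_ge0_le0 ?sqr_ge0 //.
  by move: le_m; rewrite m0.
rewrite lte_fin powRN powR12_sqrt // => t_lt.
apply: (@le_lt_trans _ _ (t ^+ 2 * m)); first by rewrite ler_wpM2l ?sqr_ge0.
have m_gt0 : 0 < Num.sqrt m by rewrite sqrtr_gt0 lt_neqAle eq_sym m0.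
rewrite -{1}(sqr_sqrtr m_ge0) -exprMn expr_lt1 //; last first.
  by rewrite mulr_ge0 ?sqrtr_ge0 // ltW.
by rewrite -ltr_pdivlMr // mul1r.
Qed.

(** Time only moves forward, so this matrix is upper triangular; its diagonal
    entry at frame s is 1 - t^2 (A_s)_ij (A_s)_ji, positive by [lt_t0]. *)
Lemma bt_factor_unit (R : realType) (n N : nat) (G : tenetwork R n N) (t : R)
    i j : 0 < t -> (t%:E < t0 G)%E ->
  bt_factor t (fiber (te_adj G)) i j \in unitmx.
Proof.
move=> t_gt0 t_lt; rewrite unitmxE unitfE -det_tr.
set B := bt_factor _ _ _ _.
have BE r s : B r s = (r == s)%:R - t ^+ 2 *
    \sum_k fiber (te_adj G) j i r k * fiber (te_adj G) i j k s.
  by rewrite /B /bt_factor !mxE.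
rewrite det_trig; last first.
  apply/is_trig_mxP => s r sr; rewrite mxE BE -val_eqE /= gtn_eqF // sub0r.
  rewrite big1 ?mulr0 ?oppr0 // => k _; rewrite !fiber_te_adj !mxE.
  case: leqP => rk; last by rewrite mul0r.
  by rewrite leqNgt (leq_trans sr rk) mulr0.
apply/prodf_neq0 => r _; rewrite mxE BE eqxx (bigD1 r) //= big1 ?addr0 => [|k kr].
  rewrite !fiber_te_adj !mxE leqnn subr_eq0 gt_eqF //.
  by have := lt_t0 j i r t_gt0 t_lt; rewrite !mxE.
rewrite !fiber_te_adj !mxE; case: ltngtP => rk; rewrite ?mulr0 ?mul0r //.
by rewrite (val_inj rk) eqxx in kr.
Qed.

Lemma fiber_map_mx (S T : Type) (f : S -> T) (n N : nat)
    (A : 'M[S]_(\sum_(_ < N) n)%N) i j :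
  fiber (map_mx f A) i j = map_mx f (fiber A i j).
Proof. by apply/matrixP => r s; rewrite !mxE. Qed.

Lemma map_pmx (R : comNzRingType) (N : nat) (A : 'M[R]_N) (t : R) :
  map_mx (horner_eval t) (pmx A) = A.
Proof. by apply/matrixP => r s; rewrite !mxE /horner_eval hornerC. Qed.

Lemma map_bt_factor (R : comNzRingType) (n N : nat)
    (a : 'I_n -> 'I_n -> 'M[R]_N) (t : R) i j :
  map_mx (horner_eval t) (bt_factor 'X (fun i j => pmx (a i j)) i j) =
  bt_factor t a i j.
Proof.
rewrite /bt_factor map_mxB map_mx1 map_mxZ map_mxM !map_pmx rmorphXn /=.
by rewrite /horner_eval hornerX.
Qed.

(* deformed laplacian, evaluated *)
(** Whatever C is chosen, its value at t is q(t) times the true inverse, so that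
    evaluation recovers the bracket of the theorem up to the factor q(t). *)
Lemma map_deformed_laplacian (R : fieldType) (n N : nat)
    (a : 'I_n -> 'I_n -> 'M[R]_N) (C : 'I_n -> 'I_n -> 'M[{poly R}]_N)
    (q : {poly R}) (t : R) :
  (forall i j, bt_factor t a i j \in unitmx) ->
  (forall i j, bt_factor 'X (fun i j => pmx (a i j)) i j *m C i j = q%:M) ->
  map_mx (horner_eval t)
    (deformed_laplacian 'X q (fun i j => pmx (a i j)) C) =
  q.[t] *: deformed_laplacian t 1 a (fun i j => invmx (bt_factor t a i j)).
Proof.
move=> uB BC; apply: fiber_inj => i j.
have mapC h k : map_mx (horner_eval t) (C h k) =
    q.[t] *: invmx (bt_factor t a h k).
  apply: (can_inj (mulKmx (uB h k))).
  rewrite -{1}map_bt_factor -map_mxM BC map_scalar_mx -scalemxAr mulmxV //.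
  by rewrite scalemx1.
have mapK h k : map_mx (horner_eval t) ('X *: (pmx (a h k) *m C h k)) =
    q.[t] *: (t *: (a h k *m invmx (bt_factor t a h k))).
  rewrite map_mxZ map_mxM map_pmx mapC -scalemxAr !scalerA /=.
  by rewrite {1}/horner_eval hornerX mulrC.
rewrite fiber_map_mx fiberZ !of_fibersK map_mxB mapK scalerBr; congr (_ - _).
case: eqP => _; last by rewrite map_mx0 scaler0.
rewrite map_mxD map_scalar_mx scalerDr scalemx1; congr (_ + _).
rewrite map_mx_sum scaler_sumr; apply: eq_bigr => h _.
rewrite map_mxZ map_mxM map_pmx mapK -scalemxAr !scalerA /=.
by rewrite {1}/horner_eval hornerX mulrC.
Qed.

(** * Growth of the coefficients and conclusion *)

Lemma horner_den_poly (R : comNzRingType) (n N : nat)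
    (a : 'I_n -> 'I_n -> 'M[R]_N) (t : R) :
  (den_poly 'X (fun i j => pmx (a i j))).[t] = den_poly t a.
Proof.
rewrite -/(horner_eval t _) rmorph_prod; apply: eq_bigr => u _.
by rewrite -det_map_mx map_bt_factor.
Qed.

(** The recursion multiplies the bounds on the entries by at most a constant
    factor. *)
Lemma nbsum_growth (R : realType) (n N : nat) (a : 'I_n -> 'I_n -> 'M[R]_N) :
  exists2 c : R, 0 < c &
    forall k h j r s, `|nbsum a k h j r s| <= n%:R * c ^+ k.
Proof.
pose alpha := \sum_(u : 'I_n * 'I_n * 'I_N * 'I_N) `|a u.1.1.1 u.1.1.2 u.1.2 u.2|.
have a_le i j r s : `|a i j r s| <= alpha.
  rewrite /alpha (bigD1 (i, j, r, s)) //= lerDl; exact: sumr_ge0.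
have alpha_ge0 : 0 <= alpha by exact: sumr_ge0.
(* A step sums over N frames the at most (n + 1) c^k alpha coming from the
   difference in [nbsum_lastS]; the summand 1 only makes c positive. *)
pose c := N%:R * (n%:R + 1) * alpha + 1.
have c_gt0 : 0 < c by rewrite ltr_wpDl // !mulr_ge0 // addr_ge0.
have growth k : (forall h j r s, `|nbsum a k h j r s| <= n%:R * c ^+ k) /\
    (forall h i j r s, `|nbsum_last a k h i j r s| <= c ^+ k).
  elim: k => [|k [IHp IHl]].
    split=> [h j r s|h i j r s]; last by rewrite mxE normr0.
    rewrite nbsum0 expr0 mulr1; have n1 : 1 <= n%:R :> R.
      by rewrite ler1n; case: n h {j} a {alpha a_le alpha_ge0 c c_gt0} => // - [].
    have [_|_] := eqVneq h j; last by rewrite mxE normr0 ler0n.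
    by rewrite mxE; case: (r == s); rewrite ?normr1 ?normr0.
  have last_le h i j r s : `|nbsum_last a k.+1 h i j r s| <= c ^+ k.+1.
    rewrite nbsum_lastS mxE; apply: le_trans (ler_norm_sum _ _ _) _.
    apply: (@le_trans _ _ (\sum_(l < N) (n%:R * c ^+ k + c ^+ k) * alpha)).
      apply: ler_sum => l _; rewrite normrM ler_pM // !mxE.
      by apply: le_trans (ler_normB _ _) _; apply: lerD.
    rewrite sumr_const card_ord -mulr_natl exprSr.
    have := exprn_ge0 k (ltW c_gt0); move: (c ^+ k) => e e_ge0.
    by rewrite -subr_ge0 [X in 0 <= X](_ : _ = e) // /c; ring.
  split=> // h j r s; rewrite nbsumS summxE.
  apply: le_trans (ler_norm_sum _ _ _) _.
  apply: (@le_trans _ _ (\sum_(i < n) c ^+ k.+1)); first by apply: ler_sum.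
  by rewrite sumr_const card_ord mulr_natl.
by exists c => // k; exact: (growth k).1.
Qed.

Lemma cvg_psi_series (R : realType) (n N : nat) (G : tenetwork R n N) :
  exists2 rho : R, 0 < rho &
    forall t : R, 0 < t -> t < rho -> cvgn (psi_series G t).
Proof.
have [c c_gt0 le_c] := nbsum_growth (fiber (te_adj G)).
(* The coefficients are dominated by those of a geometric series. *)
exists c^-1; first by rewrite invr_gt0.
move=> t t_gt0 t_lt.
have cvg_entry x y : cvgn (series (fun k => t ^+ k * nbt G k x y)).
  apply: normed_cvg; apply: (@series_le_cvg _ _ (geometric n%:R (t * c))).
  - by move=> k; exact: normr_ge0.
  - by move=> k; rewrite /= mulr_ge0 // exprn_ge0 // mulr_ge0 // ltW.
  - move=> k /=; rewrite normrM ger0_norm ?exprn_ge0 ?(ltW t_gt0) // exprMn.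
    rewrite mulrCA ler_wpM2l ?exprn_ge0 ?(ltW t_gt0) //.
    have := le_c k (tagnat.sig2 x) (tagnat.sig2 y) (tagnat.sig1 x) (tagnat.sig1 y).
    by rewrite -fiber_nbt !mxE !tagnat.sig2K.
  - apply: is_cvg_geometric_series.
    rewrite ger0_norm ?mulr_ge0 ?(ltW t_gt0) ?(ltW c_gt0) //.
    by rewrite -ltr_pdivlMr // mul1r.
apply/cvg_ex; exists (\matrix_(x, y) limn (series (fun k => t ^+ k * nbt G k x y))).
apply/cvg_mxP => x y; rewrite mxE.
rewrite [X in X @ _](_ : _ = series (fun k => t ^+ k * nbt G k x y)).
  exact: cvg_entry.
apply/funext => m; rewrite /psi_series /series /= summxE.
by apply: eq_bigr => k _; rewrite mxE.
Qed.

Lemma fiber_bt_factor (R : realType) (n N : nat) (A : 'BM[R]_(n, N)) (t : R)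
    i j :
  fiber (star1 R n N - t ^+ 2 *: star (star_tr A) A) i j =
  bt_factor t (fiber A) i j.
Proof.
by rewrite fiberD fiberN fiberZ fiber_star1 fiber_star fiber_star_tr.
Qed.

(** Fiberwise, K is K_ij = t a_ij (1 - t^2 a_ji a_ij)^-1, and only the diagonal
    fibers of t A K, the sums of t a_ih K_hi over h, survive [star_dd]. *)
Lemma bracketE (R : realType) (n N : nat) (A W : 'BM[R]_(n, N)) (t : R) :
  is_star_inv (star1 R n N - t ^+ 2 *: star (star_tr A) A) W ->
  let K := star (t *: A) W in
  1%:M - K + star_dd ((t *: A) *m K) =
  deformed_laplacian t 1 (fiber A)
    (fun i j => invmx (bt_factor t (fiber A) i j)).
Proof.
move=> /is_star_invP WE K.
have KE i j : fiber K i j =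
    t *: (fiber A i j *m invmx (bt_factor t (fiber A) i j)).
  by rewrite fiber_star fiberZ -scalemxAl (WE i j).2 fiber_bt_factor.
apply: fiber_inj => i j.
rewrite of_fibersK fiberD fiberD fiberN fiber_scalar KE fiber_star_dd.
case: eqP => [<-|_]; last by rewrite addr0.
rewrite fiberM addrAC; congr (_ + _ - _); apply: eq_bigr => h _.
by rewrite fiberZ KE -scalemxAl.
Qed.

Theorem theorem3p11 (R : realType) (n N : nat) (n_gt0 : (0 < n)%N)
    (N_gt0 : (0 < N)%N) (G : tenetwork R n N) :
  let A := te_adj G in
  (exists2 rho : R, 0 < rho &
     forall t : R, 0 < t -> t < rho -> cvgn (psi_series G t)) /\
  forall t : R, 0 < t -> (t%:E < t0 G)%E ->
    (exists X, is_star_inv (star1 R n N - t ^+ 2 *: star (star_tr A) A) X) /\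
    let K := star (t *: A)
               (star_inv (star1 R n N - t ^+ 2 *: star (star_tr A) A)) in
    let M := 1%:M - K + star_dd ((t *: A) *m K) in
    (cvgn (psi_series G t) -> M \in unitmx /\ psi G t = invmx M) /\
    (forall V, gen_value (nbt G) t V <-> M \in unitmx /\ V = invmx M).
Proof.
move=> A; split; first exact: cvg_psi_series.
move=> t t_gt0 t_lt.
have uB i j : bt_factor t (fiber A) i j \in unitmx by exact: bt_factor_unit.
have exX : exists X,
    is_star_inv (star1 R n N - t ^+ 2 *: star (star_tr A) A) X.
  exists (of_fibers (fun i j => invmx (bt_factor t (fiber A) i j))).
  by apply/is_star_invP => i j; rewrite of_fibersK fiber_bt_factor.
split=> // K M.
have ME : M = _ := bracketE (xgetPex 0 exX).
(* L is the polynomial bracket, with L(t) = q(t) M. *)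
pose a i j := pmx (fiber A i j).
pose q := den_poly 'X a.
pose L := deformed_laplacian 'X q a (bt_coinv 'X a).
have PL : formal_mul (nbt G) L q%:M.
  by apply: formal_mul_nbt => i j; exact: bt_coinvE.
have q0 : q.[t] != 0.
  by rewrite horner_den_poly; apply/prodf_neq0 => u _; rewrite -unitfE -unitmxE.
have LM : map_mx (horner_eval t) L = q.[t] *: M.
  by rewrite ME; apply: map_deformed_laplacian => // i j; exact: bt_coinvE.
(* Everything reduces to V M = 1, once multiplied by q(t). *)
have right_inv V : V *m (q.[t] *: M) = (q.[t])%:M -> M \in unitmx /\ V = invmx M.
  rewrite -scalemxAr -scalemx1 => /(can_inj (scalerK q0)) VM.
  have [_ uM] := mulmx1_unit VM; split=> //.
  by apply: (can_inj (mulmxK uM)); rewrite VM mulVmx.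
have forward V : gen_value (nbt G) t V -> M \in unitmx /\ V = invmx M.
  move=> /gen_valueP[num [den [d0 Pnum VE]]]; apply: right_inv.
  (* Both sides are den times the generating function times L. *)
  have E : num *m L = den *: q%:M.
    apply: (formal_mul_inj (P := nbt G) (B := den *: L)).
      by rewrite -mul_scalar_mx; apply: formal_mul_mulr.
    by rewrite -!mul_mx_scalar; apply: formal_mul_mulr.
  apply: (can_inj (scalerK d0)).
  rewrite scalemxAl VE -LM -map_mxM E map_mxZ map_scalar_mx //.
split=> [cv|V].
  apply: right_inv; rewrite -LM -[RHS](map_scalar_mx (horner_eval t)).
  exact: lim_formal_mul.
split=> [/forward //|[uM ->]].
(* Cramer's rule: P L = q gives (det L) P = q (adj L), and det L does not
   vanish at t because M is invertible.  The value so obtained must be the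
   inverse of M, by the converse implication. *)
pose V' := (\det L).[t]^-1 *: map_mx (horner_eval t) (q *: \adj L).
have d0 : (\det L).[t] != 0.
  rewrite -/(horner_eval t (\det L)) -det_map_mx LM detZ mulf_neq0 ?expf_neq0 //.
  by rewrite -unitfE -unitmxE.
have V'gen : gen_value (nbt G) t V'.
  apply/gen_valueP; exists (q *: \adj L), (\det L); split=> //.
    by rewrite -mul_mx_adj -mul_scalar_mx; apply: formal_mul_mulr.
  by rewrite scalerA divff // scale1r.
by have [_ <-] := forward _ V'gen.
Qed.
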